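(* Let $\Bbbk$ be a field, let $q\in\Bbbk^*$ have a square root in $\Bbbk$, let $\sigma_{inv}$ be the automorphism of $\Bbbk[h^{\pm 1}]$ with $\sigma_{inv}(h)=qh^{-1}$, and let $a=a(h)\in\Bbbk[h^{\pm 1}]$ be not a monomial. Then the center of the generalized Weyl algebra $\Bbbk[h^{\pm 1}](\sigma_{inv},a)$ is isomorphic to the generalized Weyl algebra $\Bbbk[h+qh^{-1}](\mathrm{id},a(h)a(qh^{-1}))$.
   Context: For a $\Bbbk$-algebra $R$, a $\Bbbk$-algebra automorphism $\sigma$ of $R$ and a central element $a\in R$, the (degree-one) generalized Weyl algebra $R(\sigma,a)$ is the $\Bbbk$-algebra extension of $R$ generated by two indeterminates $x$ and $y$ subject to the relations $yx=a$, $xy=\sigma(a)$, $xr=\sigma(r)x$ and $yr=\sigma^{-1}(r)y$ for all $r\in R$. A monomial in $\Bbbk[h^{\pm 1}]$ is an element $c h^i$ with $c\in\Bbbk$ and $i\in\mathbb{Z}$ (so a non-monomial is in particular nonzero). $\Bbbk[h+qh^{-1}]$ is the subalgebra of $\Bbbk[h^{\pm 1}]$ generated by $h+qh^{-1}$; it contains $a(h)a(qh^{-1})$. *)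

(* Defs.v *)
From HB Require Import structures.
From mathcomp Require Import all_boot all_order all_algebra.
From mathcomp Require Import finmap monalg boolp.

Set Implicit Arguments.
Unset Strict Implicit.
Unset Printing Implicit Defensive.

Import GRing.Theory.

Local Open Scope ring_scope.
Local Open Scope quotient_scope.

Definition alg_isomorphic (k : fieldType) (A B : algType k) : Prop :=
  exists f : {lrmorphism A -> B}, bijective f.

Record alg_aut (k : fieldType) (R : algType k) := AlgAut {
  aut_fun :> {lrmorphism R -> R};
  aut_inv : R -> R;
  aut_funK : cancel aut_fun aut_inv;
  aut_invK : cancel aut_inv aut_fun }.

Definition id_aut (k : fieldType) (R : algType k) : alg_aut R :=
  @AlgAut k R idfun idfun (fun=> erefl) (fun=> erefl).

Section Center.
Variables (k : fieldType) (A : algType k).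

Definition is_central : {pred A} := fun z => `[< forall w : A, z * w = w * z >].

Lemma is_centralP z : reflect (forall w : A, z * w = w * z) (z \in is_central).
Proof. exact: asboolP. Qed.

Fact is_central_subalg_closed : GRing.subalg_closed is_central.
Proof.
split=> [|c u v /is_centralP uC /is_centralP vC|u v /is_centralP uC /is_centralP vC].
- by apply/is_centralP => w; rewrite mulr1 mul1r.
- by apply/is_centralP => w; rewrite mulrDl mulrDr -scalerAl -scalerAr uC vC.
- by apply/is_centralP => w; rewrite -mulrA vC mulrA uC mulrA.
Qed.
HB.instance Definition _ :=
  GRing.isSubalgClosed.Build k A is_central is_central_subalg_closed.

Record center := Center { center_val : A; center_valP : center_val \in is_central }.
HB.instance Definition _ := [isSub for center_val].
HB.instance Definition _ := [Choice of center by <:].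
HB.instance Definition _ := [SubChoice_isSubAlgebra of center by <:].

End Center.

Fact is_central_com (k : fieldType) (A : comAlgType k) (a : A) : a \in @is_central k A.
Proof. by apply/is_centralP => w; rewrite mulrC. Qed.

Definition com_central (k : fieldType) (A : comAlgType k) (a : A) : center A :=
  Center (is_central_com a).

Section Adjoin.
Variables (k : fieldType) (A : comAlgType k) (u : A).

(* membership in k[u], the smallest subalgebra of A that contains u *)
Definition in_adjoin : {pred A} := fun v =>
  `[< forall S : {pred A}, GRing.subalg_closed S -> u \in S -> v \in S >].

Lemma in_adjoinP v :
  reflect (forall S : {pred A}, GRing.subalg_closed S -> u \in S -> v \in S)
          (v \in in_adjoin).
Proof. exact: asboolP. Qed.

Fact in_adjoin_subalg_closed : GRing.subalg_closed in_adjoin.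
Proof.
split=> [|c v w /in_adjoinP vS /in_adjoinP wS|v w /in_adjoinP vS /in_adjoinP wS];
  apply/in_adjoinP => S Sc uS; have [S1 SL SM] := Sc => //.
- by apply: SL; [apply: vS | apply: wS].
- by apply: SM; [apply: vS | apply: wS].
Qed.
HB.instance Definition _ :=
  GRing.isSubalgClosed.Build k A in_adjoin in_adjoin_subalg_closed.

Lemma mem_adjoin : u \in in_adjoin.
Proof. by apply/in_adjoinP. Qed.

Record adjoin := Adjoin { adjoin_val : A; adjoin_valP : adjoin_val \in in_adjoin }.
HB.instance Definition _ := [isSub for adjoin_val].
HB.instance Definition _ := [Choice of adjoin by <:].
HB.instance Definition _ := [SubChoice_isSubAlgebra of adjoin by <:].
HB.instance Definition _ := [SubNzRing_isSubComNzRing of adjoin by <:].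
HB.instance Definition _ := GRing.ComAlgebra.on adjoin.

End Adjoin.

(* R(sigma, a) is the set of noncommutative polynomial expressions in x, y and
   the elements of R, modulo the smallest congruence that contains the axioms
   of a unital ring extending the operations of R and the four families of
   defining relations.  The scalars of k act through R. *)
Section GWA.
Variables (k : fieldType) (R : algType k) (sigma : alg_aut R) (a : center R).

Inductive gwa_expr : Type :=
  | GConst of R
  | GX
  | GY
  | GOpp of gwa_expr
  | GAdd of gwa_expr & gwa_expr
  | GMul of gwa_expr & gwa_expr.

HB.instance Definition _ := gen_eqMixin gwa_expr.
HB.instance Definition _ := gen_choiceMixin gwa_expr.

Inductive gwa_eq : gwa_expr -> gwa_expr -> Prop :=
  | gwa_refl s : gwa_eq s s
  | gwa_sym s t : gwa_eq s t -> gwa_eq t s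
  | gwa_trans s t u : gwa_eq s t -> gwa_eq t u -> gwa_eq s u
  | gwa_congN s s' : gwa_eq s s' -> gwa_eq (GOpp s) (GOpp s')
  | gwa_congD s s' t t' :
      gwa_eq s s' -> gwa_eq t t' -> gwa_eq (GAdd s t) (GAdd s' t')
  | gwa_congM s s' t t' :
      gwa_eq s s' -> gwa_eq t t' -> gwa_eq (GMul s t) (GMul s' t')
  | gwa_addA s t u : gwa_eq (GAdd s (GAdd t u)) (GAdd (GAdd s t) u)
  | gwa_addC s t : gwa_eq (GAdd s t) (GAdd t s)
  | gwa_add0 s : gwa_eq (GAdd (GConst 0) s) s
  | gwa_addN s : gwa_eq (GAdd (GOpp s) s) (GConst 0)
  | gwa_mulA s t u : gwa_eq (GMul s (GMul t u)) (GMul (GMul s t) u)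
  | gwa_mul1 s : gwa_eq (GMul (GConst 1) s) s
  | gwa_mulr1 s : gwa_eq (GMul s (GConst 1)) s
  | gwa_mulDl s t u : gwa_eq (GMul (GAdd s t) u) (GAdd (GMul s u) (GMul t u))
  | gwa_mulDr s t u : gwa_eq (GMul s (GAdd t u)) (GAdd (GMul s t) (GMul s u))
  | gwa_constD r s : gwa_eq (GConst (r + s)) (GAdd (GConst r) (GConst s))
  | gwa_constM r s : gwa_eq (GConst (r * s)) (GMul (GConst r) (GConst s))
  | gwa_yx : gwa_eq (GMul GY GX) (GConst (val a))
  | gwa_xy : gwa_eq (GMul GX GY) (GConst (sigma (val a)))
  | gwa_xr r : gwa_eq (GMul GX (GConst r)) (GMul (GConst (sigma r)) GX)
  | gwa_yr r : gwa_eq (GMul GY (GConst r)) (GMul (GConst (aut_inv sigma r)) GY).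

(* The representation of R(sigma, a) on R by x |-> sigma,
   y |-> a sigma^-1 and r |-> (left multiplication by r); it shows that the
   congruence is not trivial. *)
Fixpoint gwa_act (t : gwa_expr) : R -> R :=
  match t with
  | GConst r => fun f => r * f
  | GX => sigma
  | GY => fun f => val a * aut_inv sigma f
  | GOpp s => fun f => - gwa_act s f
  | GAdd s t => fun f => gwa_act s f + gwa_act t f
  | GMul s t => fun f => gwa_act s (gwa_act t f)
  end.

Fact aut_invD : {morph aut_inv sigma : r s / r + s}.
Proof.
by move=> r s; apply: (can_inj (aut_funK sigma)); rewrite rmorphD /= !aut_invK.
Qed.

Fact aut_invM : {morph aut_inv sigma : r s / r * s}.
Proof.
by move=> r s; apply: (can_inj (aut_funK sigma)); rewrite rmorphM /= !aut_invK.
Qed.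

Fact gwa_actD t : {morph gwa_act t : f g / f + g}.
Proof.
elim: t => [r|||s IHs|s IHs t IHt|s IHs t IHt] f g /=; rewrite ?mulrDr ?rmorphD //.
- by rewrite aut_invD mulrDr.
- by rewrite IHs opprD.
- by rewrite IHs IHt addrACA.
- by rewrite IHt IHs.
Qed.

Fact gwa_act_eq s t : gwa_eq s t -> gwa_act s =1 gwa_act t.
Proof.
have aC (r : R) : val a * r = r * val a by have /is_centralP := valP a.
elim=> //= {s t}.
- by move=> s t _ IH f; rewrite IH.
- by move=> s t u _ IH1 _ IH2 f; rewrite IH1 IH2.
- by move=> s s' _ IHs f; rewrite IHs.
- by move=> s s' t t' _ IHs _ IHt f; rewrite IHs IHt.
- by move=> s s' t t' _ IHs _ IHt f; rewrite IHt IHs.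
- by move=> s t u f; rewrite addrA.
- by move=> s t f; rewrite addrC.
- by move=> s f; rewrite mul0r add0r.
- by move=> s f; rewrite mul0r addNr.
- by move=> s f; rewrite mul1r.
- by move=> s f; rewrite mul1r.
- by move=> s t u f; rewrite gwa_actD.
- by move=> r s f; rewrite mulrDl.
- by move=> r s f; rewrite mulrA.
- by move=> f; rewrite aut_funK.
- by move=> f; rewrite rmorphM /= aut_invK.
- by move=> r f; rewrite rmorphM.
- by move=> r f; rewrite aut_invM !mulrA aC.
Qed.

Definition gwa_eqb : rel gwa_expr := fun s t => `[< gwa_eq s t >].

Fact gwa_eqb_equiv : equiv_class_of gwa_eqb.
Proof.
split=> [s|s t|s t u]; first by apply/asboolP; apply: gwa_refl.
- by apply/asboolP/asboolP; apply: gwa_sym.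
- by move=> /asboolP ts /asboolP su; apply/asboolP; apply: gwa_trans ts su.
Qed.
Canonical gwa_equiv : equiv_rel gwa_expr := EquivRelPack gwa_eqb_equiv.

Definition gwa : Type := {eq_quot gwa_equiv}.
HB.instance Definition _ := Choice.on gwa.

Definition gwa_class (t : gwa_expr) : gwa := \pi_{eq_quot gwa_equiv} t.

Lemma gwa_classP s t : gwa_class s = gwa_class t <-> gwa_eq s t.
Proof. by split=> [/eqmodP/asboolP|st]; last by apply/eqmodP/asboolP. Qed.

Lemma gwa_reprK (u : gwa) : gwa_class (repr u) = u.
Proof. exact: reprK. Qed.

Lemma gwa_repr t : gwa_eq (repr (gwa_class t)) t.
Proof. by apply/gwa_classP; rewrite gwa_reprK. Qed.

Definition gwa_zero : gwa := gwa_class (GConst 0).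
Definition gwa_one : gwa := gwa_class (GConst 1).
Definition gwa_add (u v : gwa) : gwa := gwa_class (GAdd (repr u) (repr v)).
Definition gwa_mul (u v : gwa) : gwa := gwa_class (GMul (repr u) (repr v)).
Definition gwa_opp (u : gwa) : gwa := gwa_class (GOpp (repr u)).
Definition gwa_scale (c : k) (u : gwa) : gwa :=
  gwa_class (GMul (GConst c%:A) (repr u)).

Fact gwa_addE s t : gwa_add (gwa_class s) (gwa_class t) = gwa_class (GAdd s t).
Proof. by apply/gwa_classP; apply: gwa_congD; apply: gwa_repr. Qed.

Fact gwa_mulE s t : gwa_mul (gwa_class s) (gwa_class t) = gwa_class (GMul s t).
Proof. by apply/gwa_classP; apply: gwa_congM; apply: gwa_repr. Qed.

Fact gwa_oppE s : gwa_opp (gwa_class s) = gwa_class (GOpp s).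
Proof. by apply/gwa_classP; apply: gwa_congN; apply: gwa_repr. Qed.

Fact gwa_scaleE c u : gwa_scale c u = gwa_mul (gwa_class (GConst c%:A)) u.
Proof. by rewrite -{2}[u]gwa_reprK gwa_mulE. Qed.

Fact gwa_ind (P : gwa -> Prop) : (forall t, P (gwa_class t)) -> forall u, P u.
Proof. by move=> Pt u; rewrite -[u]gwa_reprK. Qed.

Fact gwa_add_assoc : associative gwa_add.
Proof.
elim/gwa_ind=> s; elim/gwa_ind=> t; elim/gwa_ind=> u.
by rewrite !gwa_addE; apply/gwa_classP; apply: gwa_addA.
Qed.

Fact gwa_add_comm : commutative gwa_add.
Proof.
elim/gwa_ind=> s; elim/gwa_ind=> t.
by rewrite !gwa_addE; apply/gwa_classP; apply: gwa_addC.
Qed.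

Fact gwa_add_0l : left_id gwa_zero gwa_add.
Proof.
by elim/gwa_ind=> s; rewrite gwa_addE; apply/gwa_classP; apply: gwa_add0.
Qed.

Fact gwa_mul_assoc : associative gwa_mul.
Proof.
elim/gwa_ind=> s; elim/gwa_ind=> t; elim/gwa_ind=> u.
by rewrite !gwa_mulE; apply/gwa_classP; apply: gwa_mulA.
Qed.

Fact gwa_mul_1l : left_id gwa_one gwa_mul.
Proof.
by elim/gwa_ind=> s; rewrite gwa_mulE; apply/gwa_classP; apply: gwa_mul1.
Qed.

Fact gwa_mul_1r : right_id gwa_one gwa_mul.
Proof.
by elim/gwa_ind=> s; rewrite gwa_mulE; apply/gwa_classP; apply: gwa_mulr1.
Qed.

Fact gwa_mul_Dl : left_distributive gwa_mul gwa_add.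
Proof.
elim/gwa_ind=> s; elim/gwa_ind=> t; elim/gwa_ind=> u.
by rewrite gwa_addE !gwa_mulE gwa_addE; apply/gwa_classP; apply: gwa_mulDl.
Qed.

Fact gwa_mul_Dr : right_distributive gwa_mul gwa_add.
Proof.
elim/gwa_ind=> s; elim/gwa_ind=> t; elim/gwa_ind=> u.
by rewrite gwa_addE !gwa_mulE gwa_addE; apply/gwa_classP; apply: gwa_mulDr.
Qed.

Fact gwa_class_constD r s :
  gwa_class (GConst (r + s)) = gwa_add (gwa_class (GConst r)) (gwa_class (GConst s)).
Proof. by rewrite gwa_addE; apply/gwa_classP; apply: gwa_constD. Qed.

Fact gwa_class_constM r s :
  gwa_class (GConst (r * s)) = gwa_mul (gwa_class (GConst r)) (gwa_class (GConst s)).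
Proof. by rewrite gwa_mulE; apply/gwa_classP; apply: gwa_constM. Qed.

Fact gwa_add_Nl : left_inverse gwa_zero gwa_opp gwa_add.
Proof.
elim/gwa_ind=> s.
by rewrite gwa_oppE gwa_addE; apply/gwa_classP; apply: gwa_addN.
Qed.

Fact gwa_one_neq0 : gwa_one != gwa_zero.
Proof.
apply/eqP => /gwa_classP/gwa_act_eq /(_ 1) /= /eqP.
by rewrite !mulr1 oner_eq0.
Qed.

HB.instance Definition _ := GRing.isZmodule.Build gwa
  gwa_add_assoc gwa_add_comm gwa_add_0l gwa_add_Nl.
HB.instance Definition _ := GRing.Zmodule_isNzRing.Build gwa
  gwa_mul_assoc gwa_mul_1l gwa_mul_1r gwa_mul_Dl gwa_mul_Dr gwa_one_neq0.

Definition gwa_const (r : R) : gwa := gwa_class (GConst r).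
Definition gwa_x : gwa := gwa_class GX.
Definition gwa_y : gwa := gwa_class GY.

Fact gwa_const_additive : nmod_morphism gwa_const.
Proof. by split=> // r s; rewrite /gwa_const gwa_class_constD. Qed.

Fact gwa_const_monoid : monoid_morphism gwa_const.
Proof. by split=> // r s; rewrite /gwa_const gwa_class_constM. Qed.

HB.instance Definition _ := GRing.isNmodMorphism.Build R gwa gwa_const
  gwa_const_additive.
HB.instance Definition _ := GRing.isMonoidMorphism.Build R gwa gwa_const
  gwa_const_monoid.

Lemma gwa_yxE : gwa_y * gwa_x = gwa_const (val a).
Proof. by rewrite [LHS]gwa_mulE; apply/gwa_classP; apply: gwa_yx. Qed.

Lemma gwa_xyE : gwa_x * gwa_y = gwa_const (sigma (val a)).
Proof. by rewrite [LHS]gwa_mulE; apply/gwa_classP; apply: gwa_xy. Qed.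

Lemma gwa_xrE r : gwa_x * gwa_const r = gwa_const (sigma r) * gwa_x.
Proof. by rewrite [LHS]gwa_mulE [RHS]gwa_mulE; apply/gwa_classP; apply: gwa_xr. Qed.

Lemma gwa_yrE r : gwa_y * gwa_const r = gwa_const (aut_inv sigma r) * gwa_y.
Proof. by rewrite [LHS]gwa_mulE [RHS]gwa_mulE; apply/gwa_classP; apply: gwa_yr. Qed.

Lemma gwa_elim (P : gwa -> Prop) :
    (forall r, P (gwa_const r)) -> P gwa_x -> P gwa_y ->
    (forall u, P u -> P (- u)) ->
    (forall u v, P u -> P v -> P (u + v)) ->
    (forall u v, P u -> P v -> P (u * v)) ->
  forall u, P u.
Proof.
move=> Pr Px Py PN PD PM; elim/gwa_ind; elim=> // [s Ps|s Ps t Pt|s Ps t Pt].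
- by rewrite -gwa_oppE; apply: PN.
- by rewrite -gwa_addE; apply: PD.
- by rewrite -gwa_mulE; apply: PM.
Qed.

Fact aut_inv_scalar (c : k) : aut_inv sigma c%:A = c%:A.
Proof. by rewrite -[in LHS](rmorph_alg sigma) aut_funK. Qed.

Fact gwa_scalar_comm (c : k) u : gwa_const c%:A * u = u * gwa_const c%:A.
Proof.
elim/gwa_elim: u => [r||| u IH|u v IHu IHv|u v IHu IHv].
- by rewrite -!rmorphM -scalerAl -scalerAr mul1r mulr1.
- by rewrite gwa_xrE rmorph_alg.
- by rewrite gwa_yrE aut_inv_scalar.
- by rewrite mulrN mulNr IH.
- by rewrite mulrDr mulrDl IHu IHv.
- by rewrite mulrA IHu -mulrA IHv mulrA.
Qed.

Fact gwa_scaleA c d u : gwa_scale c (gwa_scale d u) = gwa_scale (c * d) u.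
Proof.
rewrite !gwa_scaleE [LHS]gwa_mul_assoc -gwa_class_constM.
by rewrite -scalerAl mul1r scalerA.
Qed.

Fact gwa_scale1 : left_id 1 gwa_scale.
Proof. by move=> u; rewrite gwa_scaleE scale1r; apply: gwa_mul_1l. Qed.

Fact gwa_scaleDr : right_distributive gwa_scale +%R.
Proof. by move=> c u v; rewrite !gwa_scaleE; apply: gwa_mul_Dr. Qed.

Fact gwa_scaleDl u : {morph gwa_scale^~ u : c d / c + d}.
Proof.
by move=> c d; rewrite !gwa_scaleE scalerDl gwa_class_constD; apply: gwa_mul_Dl.
Qed.

HB.instance Definition _ := GRing.Zmodule_isLmodule.Build k gwa
  gwa_scaleA gwa_scale1 gwa_scaleDr gwa_scaleDl.

Lemma gwa_scalarE (c : k) (u : gwa) : c *: u = gwa_const c%:A * u.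
Proof. exact: gwa_scaleE. Qed.

Fact gwa_scaleAl (c : k) (u v : gwa) : c *: (u * v) = c *: u * v.
Proof. by rewrite !gwa_scalarE mulrA. Qed.
HB.instance Definition _ := GRing.Lmodule_isLalgebra.Build k gwa gwa_scaleAl.

Fact gwa_scaleAr (c : k) (u v : gwa) : c *: (u * v) = u * (c *: v).
Proof. by rewrite !gwa_scalarE mulrA gwa_scalar_comm -mulrA. Qed.
HB.instance Definition _ := GRing.Lalgebra_isAlgebra.Build k gwa gwa_scaleAr.

Fact gwa_const_scalable : scalable gwa_const.
Proof. by move=> c r; rewrite gwa_scalarE -rmorphM -scalerAl mul1r. Qed.
HB.instance Definition _ := GRing.isScalable.Build k R gwa *:%R gwa_const
  gwa_const_scalable.

Lemma gwa_universal (B : algType k) (f : {lrmorphism R -> B}) (x y : B) :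
    y * x = f (val a) -> x * y = f (sigma (val a)) ->
    (forall r, x * f r = f (sigma r) * x) ->
    (forall r, y * f r = f (aut_inv sigma r) * y) ->
  exists! g : gwa -> B,
    [/\ linear g, monoid_morphism g, g \o gwa_const =1 f, g gwa_x = x & g gwa_y = y].
Proof.
move=> yx xy xr yr.
pose ev := fix ev t := match t with
  | GConst r => f r | GX => x | GY => y | GOpp s => - ev s
  | GAdd s t => ev s + ev t | GMul s t => ev s * ev t end.
have evP s t : gwa_eq s t -> ev s = ev t.
  elim=> //= {s t}; do ?[by move=> *; congr (_ _ _) | by move=> *; congruence].
  - by move=> *; rewrite addrA.
  - by move=> *; rewrite addrC.
  - by move=> s; rewrite rmorph0 add0r.
  - by move=> s; rewrite rmorph0 addNr.
  - by move=> *; rewrite mulrA.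
  - by move=> s; rewrite rmorph1 mul1r.
  - by move=> s; rewrite rmorph1 mulr1.
  - by move=> *; rewrite mulrDl.
  - by move=> *; rewrite mulrDr.
  - by move=> *; rewrite rmorphD.
  - by move=> *; rewrite rmorphM.
pose g (u : gwa) := ev (repr u).
have gE t : g (gwa_class t) = ev t by apply: evP; apply: gwa_repr.
have gD : {morph g : u v / u + v}.
  by elim/gwa_ind=> s; elim/gwa_ind=> t; rewrite [_ + _]gwa_addE !gE.
have gM : {morph g : u v / u * v}.
  by elim/gwa_ind=> s; elim/gwa_ind=> t; rewrite [_ * _]gwa_mulE !gE.
exists g; split.
  split; rewrite /gwa_x /gwa_y ?gE //.
  - move=> c u v; rewrite gD gwa_scalarE gM gE /=.
    by rewrite linearZ /= rmorph1 -scalerAl mul1r.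
  - by split=> //; rewrite [LHS]gE /= rmorph1.
  - by move=> r /=; rewrite gE.
move=> g' [g'L [_ g'M] g'r g'x g'y]; apply/funext.
have g'D u v : g' (u + v) = g' u + g' v by have := g'L 1 u v; rewrite !scale1r.
have g'0 : g' 0 = 0 by have := g'L (-1) 0 0; rewrite scaler0 addr0 scaleN1r addNr.
have g'N u : g' (- u) = - g' u.
  by apply/eqP; rewrite -subr_eq0 opprK -g'D addNr g'0.
have gN u : g (- u) = - g u.
  by elim/gwa_ind: u => s; rewrite [- _]gwa_oppE !gE.
elim/gwa_elim=> [r||| u IH|u v IHu IHv|u v IHu IHv].
- by rewrite -[RHS]/((g' \o gwa_const) r) g'r gE.
- by rewrite g'x gE.
- by rewrite g'y gE.
- by rewrite gN g'N IH.
- by rewrite gD g'D IHu IHv.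
- by rewrite gM g'M IHu IHv.
Qed.

End GWA.

Section Laurent.
Variable k : fieldType.

(* k[h, h^-1]: finitely supported f : int -> k, with f@_i the coefficient of
   h^i.  The monoid algebra product of monalg is not available here, because
   its monoids have no nontrivial invertible element. *)
Definition laurent : Type := {malg k[int]}.
HB.instance Definition _ := GRing.Lmodule.on laurent.

Implicit Types (f g : laurent) (i j : int).

Fact lmul_key : unit. Proof. by []. Qed.
Definition lmul : laurent -> laurent -> laurent := locked_with lmul_key (fun f g =>
  \sum_(i <- msupp f) \sum_(j <- msupp g) << f@_i * g@_j *g i + j >>).
Canonical lmul_unlockable := [unlockable fun lmul].

(* h^i *)
Definition laurent_X i : laurent := << i >>.

Fact lmulw (d e : {fset int}) f g :
  (msupp f `<=` d)%fset -> (msupp g `<=` e)%fset ->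
  lmul f g = \sum_(i <- d) \sum_(j <- e) << f@_i * g@_j *g i + j >>.
Proof.
move=> fd ge; rewrite unlock (big_fset_incl _ fd) /=.
  apply/eq_bigr=> i _; apply/big_fset_incl => // j _ /mcoeff_outdom ->.
  by rewrite mulr0 monalgU0.
move=> i _ /mcoeff_outdom fi.
by rewrite big1 => // j _; rewrite fi mul0r monalgU0.
Qed.

Fact lmulC : commutative lmul.
Proof.
move=> f g; rewrite unlock exchange_big; apply: eq_bigr => i _.
by apply: eq_bigr => j _; rewrite mulrC addrC.
Qed.

Fact lmulDl : left_distributive lmul +%R.
Proof.
move=> f1 f2 g; rewrite (lmulw (msuppD_le f1 f2) (fsubset_refl _)).
rewrite (lmulw (fsubsetUl (msupp f1) (msupp f2)) (fsubset_refl _)).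
rewrite (lmulw (fsubsetUr (msupp f1) (msupp f2)) (fsubset_refl _)).
rewrite -big_split /=; apply/eq_bigr=> i _.
rewrite -big_split /=; apply/eq_bigr=> j _.
by rewrite mcoeffD mulrDl monalgUD.
Qed.

Fact lmul0 g : lmul 0 g = 0.
Proof. by rewrite unlock msupp0 big_seq_fset0. Qed.

Fact lmul_sum (I : Type) (r : seq I) (F : I -> laurent) g :
  lmul (\sum_(i <- r) F i) g = \sum_(i <- r) lmul (F i) g.
Proof. exact: (big_morph (lmul^~ g) (fun _ _ => lmulDl _ _ _) (lmul0 g)). Qed.

Fact lmulUU c d i j : lmul << c *g i >> << d *g j >> = << c * d *g i + j >>.
Proof. by rewrite (lmulw msuppU_le msuppU_le) !big_seq_fset1 !mcoeffUU. Qed.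

Lemma laurentE f : f = \sum_(i <- msupp f) << f@_i *g i >>.
Proof. exact: monalgE. Qed.

Lemma laurent_ind (P : laurent -> Prop) :
    P 0 -> (forall c i, P << c *g i >>) ->
    (forall f g, P f -> P g -> P (f + g)) ->
  forall f, P f.
Proof. by move=> P0 PU PD f; rewrite [f]laurentE; apply: big_ind. Qed.

Fact lmulDr : right_distributive lmul +%R.
Proof. by move=> f g1 g2; rewrite lmulC lmulDl !(lmulC f). Qed.

Fact lmulA : associative lmul.
Proof.
move=> f g e.
elim/laurent_ind: f => [|c i|f1 f2 IH1 IH2]; first by rewrite !lmul0.
  elim/laurent_ind: g => [|c' j|g1 g2 IH1 IH2].
  - by rewrite lmul0 [lmul _ 0]lmulC !lmul0.
  - elim/laurent_ind: e => [|c'' l|e1 e2 IH1 IH2].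
    + by rewrite [RHS]lmulC [lmul _ 0]lmulC !lmul0 lmulC lmul0.
    + by rewrite !lmulUU mulrA addrA.
    + by rewrite !lmulDr IH1 IH2.
  - by rewrite lmulDl !lmulDr IH1 IH2 lmulDl.
by rewrite !lmulDl IH1 IH2.
Qed.

Fact lmul1 : left_id (laurent_X 0) lmul.
Proof.
elim/laurent_ind=> [|c i|f g IHf IHg]; first by rewrite lmulC lmul0.
- by rewrite lmulUU mul1r add0r.
- by rewrite lmulDr IHf IHg.
Qed.

Fact laurent_X0_neq0 : laurent_X 0 != 0.
Proof. by rewrite monalgU_eq0 oner_eq0. Qed.

HB.instance Definition _ := GRing.Zmodule_isComNzRing.Build laurent
  lmulA lmulC lmul1 lmulDl laurent_X0_neq0.

Lemma laurent_scaleU (c d : k) i : c *: (<< d *g i >> : laurent) = << c * d *g i >>.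
Proof.
by apply/malgP=> j; rewrite [LHS]mcoeffZ !mcoeffU mulrnAr.
Qed.

Lemma laurent_mulUU (c d : k) i j :
  (<< c *g i >> : laurent) * << d *g j >> = << c * d *g i + j >>.
Proof. exact: lmulUU. Qed.

Fact laurent_scaleAl (c : k) f g : c *: (f * g) = c *: f * g.
Proof.
elim/laurent_ind: f => [|d i|f1 f2 IH1 IH2]; first by rewrite mul0r !scaler0 mul0r.
  elim/laurent_ind: g => [|e j|g1 g2 IH1 IH2]; first by rewrite !mulr0 scaler0.
  - by rewrite laurent_scaleU !laurent_mulUU laurent_scaleU mulrA.
  - by rewrite !mulrDr scalerDr IH1 IH2.
by rewrite mulrDl !scalerDr mulrDl IH1 IH2.
Qed.
HB.instance Definition _ := GRing.Lmodule_isLalgebra.Build k laurent laurent_scaleAl.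
HB.instance Definition _ := GRing.Lalgebra_isComAlgebra.Build k laurent.

Lemma laurent_XD i j : laurent_X (i + j) = laurent_X i * laurent_X j.
Proof. by rewrite [RHS]lmulUU mulr1. Qed.

Definition laurent_monomial f : Prop := exists c i, f = c *: laurent_X i.

Section Inv.
Variables (q : k) (q0 : q != 0).

(* f(h) |-> f(q h^-1) *)
Definition laurent_inv f : laurent :=
  \sum_(i <- msupp f) f@_i *: (q ^ i *: laurent_X (- i)).

Fact laurent_inv_coeff f j : (laurent_inv f)@_j = f@_(- j) * q ^ (- j).
Proof.
rewrite /laurent_inv raddf_sum /=.
have E i : (f@_i *: (q ^ i *: laurent_X (- i)))@_j =
           (f@_(- j) * q ^ (- j)) *+ (i == - j).
  rewrite !mcoeffZ mcoeffU eqr_oppLR; case: eqP => [->|_]; last by rewrite !mulr0.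
  by rewrite !mulr1.
rewrite (eq_bigr _ (fun i _ => E i)).
case: (msuppP f (- j)) => [jf|jf].
  rewrite (big_fsetD1 (- j)) //= eqxx big1_fset ?addr0 // => i.
  by rewrite in_fsetD1 => /andP[/negPf->].
rewrite mul0r; apply: big1 => i _; exact: mul0rn.
Qed.

Fact laurent_inv_additive : nmod_morphism laurent_inv.
Proof.
split=> [|f g]; apply/malgP=> j; rewrite ?mcoeffD !laurent_inv_coeff.
  by rewrite !mcoeff0 mul0r.
by rewrite mcoeffD mulrDl.
Qed.
HB.instance Definition _ := GRing.isNmodMorphism.Build laurent laurent laurent_inv
  laurent_inv_additive.

Fact laurent_inv_scalable : scalable laurent_inv.
Proof.
by move=> c f; apply/malgP=> j; rewrite mcoeffZ !laurent_inv_coeff mcoeffZ mulrA.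
Qed.
HB.instance Definition _ := GRing.isScalable.Build k laurent laurent *:%R laurent_inv
  laurent_inv_scalable.

Fact laurent_invX i : laurent_inv (laurent_X i) = q ^ i *: laurent_X (- i).
Proof.
apply/malgP=> j; rewrite laurent_inv_coeff mcoeffZ !mcoeffU eqr_oppLR.
by case: eqP => [->|_]; rewrite ?mulr0 ?mul0r // mul1r mulr1.
Qed.

Fact laurent_inv_monoid : monoid_morphism laurent_inv.
Proof.
split=> [|f g]; first by rewrite laurent_invX oppr0 expr0z scale1r.
elim/laurent_ind: f => [|c i|f1 f2 IH1 IH2]; first by rewrite mul0r raddf0 mul0r.
  elim/laurent_ind: g => [|d j|g1 g2 IH1 IH2]; first by rewrite mulr0 raddf0 mulr0.
  - have U b l : << b *g l >> = b *: laurent_X l by rewrite laurent_scaleU mulr1.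
    rewrite laurent_mulUU !U !linearZ /= !laurent_invX opprD laurent_XD.
    rewrite expfzDr // -!scalerAl -!scalerAr !scalerA; congr (_ *: _).
    by rewrite mulrACA -!mulrA; congr (_ * _); rewrite mulrCA.
  - by rewrite mulrDr !raddfD mulrDr /= IH1 IH2.
by rewrite mulrDl !raddfD mulrDl /= IH1 IH2.
Qed.
HB.instance Definition _ := GRing.isMonoidMorphism.Build laurent laurent laurent_inv
  laurent_inv_monoid.

Fact laurent_invK : involutive laurent_inv.
Proof.
move=> f; apply/malgP=> j; rewrite !laurent_inv_coeff !opprK -mulrA.
by rewrite -expfzDr // subrr expr0z mulr1.
Qed.

Definition sigma_inv : alg_aut laurent :=
  @AlgAut k laurent laurent_inv laurent_inv laurent_invK laurent_invK.

Lemma sigma_inv_h : sigma_inv (laurent_X 1) = q *: laurent_X (-1).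
Proof. by rewrite /= laurent_invX expr1z. Qed.

(* h + q h^-1 *)
Definition laurent_trace : laurent := laurent_X 1 + q *: laurent_X (-1).

Let S := in_adjoin laurent_trace.

Fact laurent_powersum_mem (m : int) :
  laurent_X m + q ^ m *: laurent_X (- m) \in S.
Proof.
have addX (w x y z : laurent) : w + z = w + x + (y + z) - (y + x).
  by rewrite [y + z]addrC addrACA [x + y]addrC addrK.
have natS (n : nat) : laurent_X n + q ^ n *: laurent_X (- n%:Z) \in S /\
   laurent_X n.+1 + q ^ n.+1 *: laurent_X (- n.+1%:Z) \in S.
  elim: n => [|n [IH0 IH1]].
    split; last by rewrite expr1z; apply: mem_adjoin.
    by rewrite expr0z scale1r oppr0; apply: rpredD; apply: rpred1.
  split; first exact: IH1.
  have -> : laurent_X n.+2 + q ^ n.+2 *: laurent_X (- n.+2%:Z) =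
      laurent_trace * (laurent_X n.+1 + q ^ n.+1 *: laurent_X (- n.+1%:Z))
      - q *: (laurent_X n + q ^ n *: laurent_X (- n%:Z)).
    rewrite /laurent_trace mulrDl !mulrDr -!scalerAl -!scalerAr -!laurent_XD.
    rewrite scalerDr !scalerA -!exprSz.
    have -> : 1 + n.+1%:Z = n.+2 by [].
    have -> : 1 + - n.+1%:Z = - n%:Z by rewrite intS opprD addNKr.
    have -> : -1 + n.+1%:Z = n by rewrite intS addKr.
    have -> : -1 + - n.+1%:Z = - n.+2%:Z by rewrite -opprD.
    exact: addX.
  exact: rpredB (rpredM (mem_adjoin _) IH1) (rpredZ _ IH0).
case: m => n; first exact: (natS n).1.
rewrite NegzE opprK addrC.
have -> : q ^ (- n.+1%:Z) *: laurent_X n.+1 + laurent_X (- n.+1%:Z) =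
    q ^ (- n.+1%:Z) *: (laurent_X n.+1 + q ^ n.+1 *: laurent_X (- n.+1%:Z)).
  by rewrite scalerDr scalerA -expfzDr // addNr expr0z scale1r.
by apply: rpredZ; case: (natS n).
Qed.

Fact laurent_polar_mem f g : f * laurent_inv g + g * laurent_inv f \in S.
Proof.
have U b l : << b *g l >> = b *: laurent_X l by rewrite laurent_scaleU mulr1.
elim/laurent_ind: f => [|c i|f1 f2 IH1 IH2].
- by rewrite raddf0 mul0r mulr0 addr0; exact: rpred0.
- elim/laurent_ind: g => [|d j|g1 g2 IH1 IH2].
  + by rewrite raddf0 mul0r mulr0 addr0; exact: rpred0.
  + rewrite (U c i) (U d j) !linearZ /= !laurent_invX -!scalerAl -!scalerAr.
    rewrite !scalerA -!laurent_XD.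
    have -> : (c * (d * q ^ j)) *: laurent_X (i - j) + (d * (c * q ^ i)) *: laurent_X (j - i) =
       (c * d * q ^ j) *: (laurent_X (i - j) + q ^ (i - j) *: laurent_X (- (i - j))).
      rewrite scalerDr scalerA opprB -(mulrA (c * d)) -expfzDr // subrKC.
      by rewrite !mulrA (mulrC d).
    exact: rpredZ (laurent_powersum_mem _).
  + rewrite raddfD mulrDr mulrDl addrACA; exact: rpredD IH1 IH2.
rewrite raddfD mulrDr mulrDl addrACA; exact: rpredD IH1 IH2.
Qed.

Lemma laurent_norm_mem f : f * laurent_inv f \in S.
Proof.
have U b l : << b *g l >> = b *: laurent_X l by rewrite laurent_scaleU mulr1.
elim/laurent_ind: f => [|c i|f g IHf IHg]; first by rewrite mul0r; exact: rpred0.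
- rewrite (U c i) linearZ /= laurent_invX -!scalerAl -!scalerAr !scalerA.
  rewrite -laurent_XD subrr; exact: rpredZ (rpred1 _).
- rewrite raddfD mulrDl !mulrDr [g * _ + _]addrC addrACA.
  exact: rpredD (rpredD IHf IHg) (laurent_polar_mem f g).
Qed.

End Inv.
End Laurent.

(* Main.v *)
Require Import Defs.
From HB Require Import structures.
From mathcomp Require Import all_boot all_order all_algebra.
From mathcomp Require Import finmap monalg boolp.
From mathcomp Require Import zify.

(* Every generalized Weyl algebra R(sigma, a) is a free left R-module on the
   basis ..., y^2, y, 1, x, x^2, ...: these elements span, and the left regular
   representation can be written down directly on coordinate functions int -> R.
   When sigma is an involution, x^2, y^2 and the sigma-fixed elements of a
   commutative R are central.  Conversely, comparing coordinates of z r = r z,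
   z x = x z and z y = y z shows that a central z has sigma-fixed coordinates,
   and that its odd coordinates f satisfy r f = f sigma(r) for all r; for
   Laurent polynomials this forces f = 0.  Hence X |-> x^2, Y |-> y^2 identifies
   k[h + q h^-1](id, a sigma(a)) with the center, because k[h + q h^-1] is the
   fixed ring of sigma_inv. *)

Set Implicit Arguments.
Unset Strict Implicit.
Unset Printing Implicit Defensive.

Import Order.TTheory GRing.Theory Num.Theory.

Local Open Scope ring_scope.

Section NormalForm.
Variables (k : fieldType) (R : algType k) (sigma : alg_aut R) (a : center R).
Local Notation A := (gwa sigma a).
Local Notation C := (@gwa_const k R sigma a).
Local Notation x := (gwa_x sigma a).
Local Notation y := (gwa_y sigma a).

Definition gwa_basis (i : int) : A :=
  match i with Posz n => x ^+ n | Negz n => y ^+ n.+1 end.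
Local Notation w := gwa_basis.

Lemma gwa_x_basis i :
  x * w i = C (if i < 0 then sigma (val a) else 1) * w (i + 1).
Proof.
case: i => [n|[|n]] /=.
- by rewrite rmorph1 mul1r addn1 exprS.
- by rewrite expr0 mulr1 expr1 gwa_xyE.
- by rewrite subn1 exprS mulrA gwa_xyE.
Qed.

Lemma gwa_y_basis i : y * w i = C (if 0 < i then val a else 1) * w (i - 1).
Proof.
case: i => [[|n]|n] /=.
- by rewrite rmorph1 mul1r expr0 mulr1 expr1.
- by rewrite subn1 /= exprS mulrA gwa_yxE.
- by rewrite addn0 rmorph1 mul1r -exprS.
Qed.

Lemma gwa_span_ind (P : A -> Prop) :
    P 0 -> (forall r i, P (C r * w i)) -> (forall u v, P u -> P v -> P (u + v)) ->
  forall u, P u.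
Proof.
move=> P0 PU PD u.
pose span v := exists s : seq (R * int), v = \sum_(p <- s) C p.1 * w p.2.
suff [s ->] : span u by apply: big_ind => //.
have spanD v v' : span v -> span v' -> span (v + v').
  by move=> [s ->] [s' ->]; exists (s ++ s'); rewrite big_cat.
have spanC r v : span v -> span (C r * v).
  move=> [s ->]; exists [seq (r * p.1, p.2) | p <- s].
  by rewrite big_map mulr_sumr; apply: eq_bigr => p _; rewrite rmorphM mulrA.
have span_sum (s : seq (R * int)) F : (forall p, span (F p)) -> span (\sum_(p <- s) F p).
  by move=> FP; apply: big_ind => //; exists [::]; rewrite big_nil.
have spanU r i : span (C r * w i) by exists [:: (r, i)]; rewrite big_seq1.
suff spanM v : span v -> span (u * v).
  by rewrite -[u]mulr1; apply: spanM; exists [:: (1, 0)]; rewrite big_seq1 rmorph1 mul1r.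
elim/gwa_elim: u v => [r v|v [s ->]|v [s ->]|u IH v sv|u u' IHu IHu' v sv|u u' IHu IHu' v sv].
- exact: spanC.
- rewrite mulr_sumr; apply: span_sum => p.
  by rewrite mulrA gwa_xrE -mulrA gwa_x_basis; apply/spanC/spanU.
- rewrite mulr_sumr; apply: span_sum => p.
  by rewrite mulrA gwa_yrE -mulrA gwa_y_basis; apply/spanC/spanU.
- by rewrite mulNr -mulN1r -[-1](rmorphN1 C); apply/spanC/IH.
- by rewrite mulrDl; apply: spanD; [apply: IHu | apply: IHu'].
- by rewrite -mulrA; apply/IHu/IHu'.
Qed.

(* Left multiplication on coordinates with respect to [gwa_basis]. *)
Fixpoint gwa_coord_act (t : gwa_expr R) (v : int -> R) : int -> R :=
  match t with
  | GConst r => fun j => r * v j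
  | GX => fun j => sigma (v (j - 1)) * (if j - 1 < 0 then sigma (val a) else 1)
  | GY => fun j => aut_inv sigma (v (j + 1)) * (if 0 < j + 1 then val a else 1)
  | GOpp s => fun j => - gwa_coord_act s v j
  | GAdd s t => fun j => gwa_coord_act s v j + gwa_coord_act t v j
  | GMul s t => gwa_coord_act s (gwa_coord_act t v)
  end.

Lemma gwa_coord_actD t (v v' : int -> R) :
  gwa_coord_act t (fun j => v j + v' j) =
  (fun j => gwa_coord_act t v j + gwa_coord_act t v' j).
Proof.
elim: t v v' => [r|||s IHs|s IHs t IHt|s IHs t IHt] v v' /=.
- by apply/funext => j; rewrite mulrDr.
- by apply/funext => j; rewrite rmorphD mulrDl.
- by apply/funext => j; rewrite aut_invD mulrDl.
- by apply/funext => j; rewrite IHs opprD.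
- by apply/funext => j; rewrite IHs IHt addrACA.
- by rewrite IHt IHs.
Qed.

Lemma gwa_coord_act_eq s t : gwa_eq sigma a s t -> gwa_coord_act s = gwa_coord_act t.
Proof.
have aC (r : R) : val a * r = r * val a by have /is_centralP := valP a.
have saC (r : R) : sigma (val a) * r = r * sigma (val a).
  by rewrite -[r](aut_invK sigma) -!rmorphM /= aC.
elim=> //= {s t}; do ?[by move=> *; apply/funext => v; apply/funext => j /=; congruence].
- by move=> s t u; apply/funext=> v; apply/funext => j; rewrite addrA.
- by move=> s t; apply/funext=> v; apply/funext => j; rewrite addrC.
- by move=> s; apply/funext=> v; apply/funext => j; rewrite mul0r add0r.
- by move=> s; apply/funext=> v; apply/funext => j; rewrite mul0r addNr.
- by move=> s; apply/funext=> v; apply/funext => j; rewrite mul1r.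
- move=> s; apply/funext=> v; congr gwa_coord_act.
  by apply/funext => j; rewrite mul1r.
- by move=> s t u; apply/funext=> v; rewrite gwa_coord_actD.
- by move=> r s; apply/funext=> v; apply/funext => j; rewrite mulrDl.
- by move=> r s; apply/funext=> v; apply/funext => j; rewrite mulrA.
- apply/funext=> v; apply/funext => j; rewrite addrK aut_invM aut_funK aC -mulrA.
  congr (_ * _); rewrite ltzD1 leNgt.
  case: ifP => _ /=; first by rewrite aut_funK mulr1.
  by rewrite -[X in aut_inv _ X](rmorph1 sigma) aut_funK mul1r.
- apply/funext=> v; apply/funext => j; rewrite subrK rmorphM /= aut_invK saC -mulrA.
  congr (_ * _); rewrite (_ : (j - 1 < 0) = ~~ (0 < j)); last
    by rewrite -leNgt -ltzD1 subr_lt0 add0r.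
  by case: ifP => _ /=; rewrite ?mulr1 // rmorph1 mul1r.
- by move=> r; apply/funext=> v; apply/funext => j; rewrite rmorphM mulrA.
- by move=> r; apply/funext=> v; apply/funext => j; rewrite aut_invM mulrA.
Qed.

Definition gwa_coef (u : A) : int -> R :=
  gwa_coord_act (repr u) (fun j => (j == 0)%:R).

Lemma gwa_coef_class t :
  gwa_coef (gwa_class sigma a t) = gwa_coord_act t (fun j => (j == 0)%:R).
Proof. by rewrite /gwa_coef (gwa_coord_act_eq (gwa_repr _ _ _)). Qed.

Lemma gwa_coefD u v j : gwa_coef (u + v) j = gwa_coef u j + gwa_coef v j.
Proof.
elim/gwa_ind: u => s; elim/gwa_ind: v => t.
by rewrite [_ + _]gwa_addE !gwa_coef_class.
Qed.

Lemma gwa_coefCM r u j : gwa_coef (C r * u) j = r * gwa_coef u j.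
Proof. by elim/gwa_ind: u => t; rewrite [_ * _]gwa_mulE !gwa_coef_class. Qed.

Lemma gwa_coef0 j : gwa_coef 0 j = 0.
Proof. by rewrite [0]/(C 0) gwa_coef_class /= mul0r. Qed.

Lemma gwa_coefXM u j : 0 <= j -> gwa_coef (x * u) (j + 1) = sigma (gwa_coef u j).
Proof.
move=> j0; elim/gwa_ind: u => t; rewrite [_ * _]gwa_mulE !gwa_coef_class /=.
by rewrite addrK ltNge j0 mulr1.
Qed.

Lemma gwa_coefYM u j :
  j <= 0 -> gwa_coef (y * u) (j - 1) = aut_inv sigma (gwa_coef u j).
Proof.
move=> j0; elim/gwa_ind: u => t; rewrite [_ * _]gwa_mulE !gwa_coef_class /=.
by rewrite subrK ltNge j0 mulr1.
Qed.

Lemma gwa_coef_basis i j : gwa_coef (w i) j = (j == i)%:R.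
Proof.
have inv_nat b : aut_inv sigma (b : bool)%:R = b%:R.
  by apply: (can_inj (aut_funK sigma)); rewrite aut_invK rmorph_nat.
have coef1 l : gwa_coef 1 l = (l == 0)%:R by rewrite [1]/(C 1) gwa_coef_class /= mul1r.
case: i => n /=; elim: n j => [|n IH] j.
- by rewrite expr0 coef1.
- rewrite exprS -[x ^+ n]gwa_reprK [_ * _]gwa_mulE gwa_coef_class /= -/(gwa_coef _) IH.
  rewrite rmorph_nat subr_eq -addn1 PoszD; case: eqP => [->|_]; last by rewrite mul0r.
  by rewrite addrK mul1r.
- rewrite expr1 -[y]mulr1 -[X in y * X]gwa_reprK [_ * _]gwa_mulE gwa_coef_class /=.
  rewrite -/(gwa_coef _) coef1 inv_nat addr_eq0.
  by case: eqP => [->|_]; rewrite ?mul0r // addNr mul1r.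
- rewrite exprS -[y ^+ n.+1]gwa_reprK [_ * _]gwa_mulE gwa_coef_class /= -/(gwa_coef _) IH.
  rewrite inv_nat -[j + 1 == _](inj_eq (addIr (-1))) addrK.
  rewrite (_ : Negz n - 1 = Negz n.+1); last by rewrite !NegzE -opprD -PoszD addn1.
  by case: eqP => [->|_]; rewrite ?mul0r // mul1r.
Qed.

Lemma gwa_coefU r i j : gwa_coef (C r * w i) j = r *+ (j == i).
Proof. by rewrite gwa_coefCM gwa_coef_basis mulr_natr. Qed.

Lemma gwa_coefE u : exists J : seq int, u = \sum_(j <- J) C (gwa_coef u j) * w j.
Proof.
suff [J [_ _ eu]] : exists J : seq int, [/\ uniq J,
    forall j, j \notin J -> gwa_coef u j = 0 & u = \sum_(j <- J) C (gwa_coef u j) * w j].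
  by exists J.
elim/gwa_span_ind: u => [|r i|u v [J [uJ J0 eu]] [K [uK K0 ev]]].
- by exists [::]; split=> //= [j _|]; rewrite ?gwa_coef0 ?big_nil.
- exists [:: i]; split=> // [j|]; last by rewrite big_seq1 gwa_coefU eqxx.
  by rewrite inE gwa_coefU => /negPf->.
have ext (L : seq int) z : uniq L -> (forall j, j \notin L -> gwa_coef z j = 0) ->
    forall M, uniq M -> {subset L <= M} ->
    \sum_(j <- L) C (gwa_coef z j) * w j = \sum_(j <- M) C (gwa_coef z j) * w j.
  move=> uL L0 M uM LM; rewrite [RHS](bigID (mem L)) /= [X in _ + X]big1 ?addr0.
    rewrite -[RHS]big_filter; apply: perm_big; apply: uniq_perm => //.
      exact: filter_uniq.
    by move=> j; rewrite mem_filter; case: (boolP (j \in L)) => // /LM ->.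
  by move=> j /L0 ->; rewrite rmorph0 mul0r.
exists (undup (J ++ K)); split; first exact: undup_uniq.
  move=> j; rewrite mem_undup mem_cat negb_or gwa_coefD => /andP[/J0-> /K0->].
  by rewrite addr0.
rewrite {1}eu {1}ev (ext J u uJ J0 (undup (J ++ K))) ?undup_uniq //; last first.
  by move=> j jJ; rewrite mem_undup mem_cat jJ.
rewrite (ext K v uK K0 (undup (J ++ K))) ?undup_uniq //; last first.
  by move=> j jK; rewrite mem_undup mem_cat jK orbT.
rewrite -big_split; apply: eq_bigr => j _ /=.
by rewrite gwa_coefD rmorphD mulrDl.
Qed.

Lemma gwa_coef_inj u v : gwa_coef u =1 gwa_coef v -> u = v.
Proof.
move=> uv; apply/eqP; rewrite -subr_eq0; apply/eqP.
have [J ->] := gwa_coefE (u - v).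
apply: big1 => j _; rewrite gwa_coefD -mulN1r -[-1](rmorphN1 C) gwa_coefCM uv.
by rewrite mulN1r subrr rmorph0 mul0r.
Qed.

Lemma gwa_coefMX u j : 0 <= j -> gwa_coef (u * x) (j + 1) = gwa_coef u j.
Proof.
move=> j0; elim/gwa_span_ind: u => [|r i|u v IHu IHv].
- by rewrite mul0r !gwa_coef0.
- rewrite gwa_coefU -mulrA gwa_coefCM; case: i => n /=.
    by rewrite -exprSr -/(w n.+1) gwa_coef_basis -addn1 PoszD (inj_eq (addIr _)) mulr_natr.
  rewrite exprSr -mulrA gwa_yxE.
  have [s ->] : exists s, y ^+ n * C (val a) = C s * y ^+ n.
    elim: n => [|n [s IH]]; first by exists (val a); rewrite mulr1 mul1r.
    exists (aut_inv sigma s).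
    by rewrite exprS -mulrA IH mulrA gwa_yrE -mulrA.
  have -> : y ^+ n = w (- n%:Z) by case: n.
  rewrite gwa_coefU; case: j j0 => // m _.
  by rewrite -addr_eq0 -!PoszD addn1 addSn mulr0.
- by rewrite mulrDl !gwa_coefD IHu IHv.
Qed.

Lemma gwa_coefMY u j : j <= 0 -> gwa_coef (u * y) (j - 1) = gwa_coef u j.
Proof.
move=> j0; elim/gwa_span_ind: u => [|r i|u v IHu IHv].
- by rewrite mul0r !gwa_coef0.
- have wN n : w (- n%:Z) = y ^+ n by case: n.
  rewrite gwa_coefU -mulrA gwa_coefCM.
  have [[n ->]|[n ->]] : (exists n : nat, i = - n%:Z) \/ (exists n : nat, i = n.+1).
    by case: i => [[|n]|n]; [left; exists 0 | right; exists n | left; exists n.+1].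
    rewrite wN -exprSr -wN gwa_coef_basis -addn1 PoszD opprD (inj_eq (addIr _)).
    by rewrite mulr_natr.
  rewrite /= exprSr -mulrA gwa_xyE.
  have [s ->] : exists s, x ^+ n * C (sigma (val a)) = C s * x ^+ n.
    elim: n => [|n [s IH]]; first by exists (sigma (val a)); rewrite mulr1 mul1r.
    exists (sigma s).
    by rewrite exprS -mulrA IH mulrA gwa_xrE -mulrA.
  rewrite -/(w n) gwa_coefU !lt_eqF ?mulr0 //.
    by rewrite (le_lt_trans j0).
  by rewrite (lt_le_trans (y := 0)) // subr_lt0 (le_lt_trans j0) // ltr01.
- by rewrite mulrDl !gwa_coefD IHu IHv.
Qed.

Lemma gwa_coef_central_fixed u j :
  u \in @is_central k A -> sigma (gwa_coef u j) = gwa_coef u j.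
Proof.
move=> /is_centralP uC; case: (leP 0 j) => [j0|/ltW j0].
  by rewrite -gwa_coefXM // -uC gwa_coefMX.
by rewrite -{1}(gwa_coefMY u j0) uC gwa_coefYM // aut_invK.
Qed.

End NormalForm.

Lemma alg_isomorphic_center (k : fieldType) (A B : algType k) (G : B -> A) :
    linear G -> monoid_morphism G -> injective G ->
    (forall z, z \in @is_central k A <-> exists b, G b = z) ->
  alg_isomorphic (center A) B.
Proof.
move=> GL [G1 GM] Ginj GP.
have [F FP] : exists F : center A -> B, forall z, G (F z) = val z.
  have ex (z : center A) : exists b, G b = val z by apply/GP/(valP z).
  by exists (fun z => projT1 (cid (ex z))) => z; case: (cid (ex z)).
have FL : linear F.
  by move=> c u v; apply: Ginj; rewrite GL !FP linearP.
have FM : monoid_morphism F.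
  by split=> [|u v]; apply: Ginj; rewrite FP ?G1 ?GM ?FP ?rmorph1 ?rmorphM.
pose FLM := GRing.isLinear.Build k (center A) B *:%R F FL.
pose FMM := GRing.isMonoidMorphism.Build (center A) B F FM.
pose f : {lrmorphism center A -> B} := HB.pack F FLM FMM.
exists f; exists (fun b => Center (introT idP (proj2 (GP (G b)) (ex_intro _ b erefl)))).
  by move=> z; apply: val_inj => /=; rewrite FP.
by move=> b; apply: Ginj; rewrite [LHS]FP.
Qed.

Section Invariants.
Variables (k : fieldType) (q : k) (q0 : q != 0).
Implicit Types f : laurent k.

Lemma adjoin_trace_fixed f :
  f \in in_adjoin (laurent_trace q) -> sigma_inv q0 f = f.
Proof.
move=> /in_adjoinP fS; apply/eqP.
apply: (fS [pred f | sigma_inv q0 f == f]).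
  split=> [|c u v|u v]; rewrite !inE; first by rewrite rmorph1.
    by move=> /eqP eu /eqP ev; rewrite (linearP (sigma_inv q0)) [X in _ *: X]eu [X in _ + X]ev.
  by move=> /eqP eu /eqP ev; rewrite rmorphM [X in X * _]eu [X in _ * X]ev.
rewrite inE /= /laurent_trace raddfD /= linearZ /= !laurent_invX expr1z opprK.
by rewrite scalerA exprN1 divff // scale1r addrC.
Qed.

Lemma fixed_adjoin_trace f :
  sigma_inv q0 f = f -> f \in in_adjoin (laurent_trace q).
Proof.
move=> ff.
have [p pE] : exists p : laurent k, forall j, p@_j = if 0 < j then f@_j else 0.
  elim/laurent_ind: {ff}f => [|c i|f g [p pE] [p' pE']].
  - by exists 0 => j; rewrite mcoeff0 if_same.
  - exists (if 0 < i then << c *g i >> else 0) => j.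
    case: ifP => i0; rewrite ?mcoeff0 mcoeffU; case: eqP => [<-|_];
      rewrite ?i0 ?if_same //.
  - by exists (p + p') => j; rewrite !mcoeffD pE pE'; case: ifP; rewrite ?addr0.
have -> : f = f@_0 *: 1 + (p * laurent_inv q 1 + 1 * laurent_inv q p).
  have -> : laurent_inv q 1 = 1 by have [] := laurent_inv_monoid q0.
  rewrite mulr1 mul1r; apply/malgP => j.
  rewrite !mcoeffD mcoeffZ [(1 : laurent k)@_j]mcoeffU laurent_inv_coeff !pE oppr_gt0.
  case: (ltgtP j 0) => [j0|j0|->]; rewrite ?mulr0 ?mulr1 ?mul0r ?add0r ?addr0 //.
  by rewrite -{1}ff /= laurent_inv_coeff.
by apply: rpredD; [apply/rpredZ/rpred1 | apply: laurent_polar_mem].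
Qed.

Lemma mcoeff_mulX f i j : (f * laurent_X k i)@_j = f@_(j - i).
Proof.
elim/laurent_ind: f => [|c l|f g IHf IHg]; first by rewrite mul0r !mcoeff0.
  by rewrite laurent_mulUU mulr1 !mcoeffU -[in RHS](inj_eq (addIr i)) subrK.
by rewrite mulrDl !mcoeffD IHf IHg.
Qed.

(* Taking r = h^n gives f@_j = q^n * f@_(j + 2n), which vanishes for large n. *)
Lemma laurent_twisted_eq0 f : (forall r, r * f = f * sigma_inv q0 r) -> f = 0.
Proof.
move=> fC; apply/malgP => j; rewrite mcoeff0.
have [N NP] : exists N : nat, forall i, N%:Z < i -> f@_i = 0.
  elim/laurent_ind: {fC}f => [|c i|f g [N NP] [M MP]].
  - by exists 0%N => i _; rewrite mcoeff0.
  - exists `|i|%N => l il; rewrite mcoeffU; case: eqP il => // ->.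
    by rewrite abszE ltNge ler_norm.
  - exists (N + M)%N => i iNM; rewrite mcoeffD NP ?MP ?addr0 //.
      by apply: le_lt_trans iNM; rewrite lez_nat leq_addl.
    by apply: le_lt_trans iNM; rewrite lez_nat leq_addr.
pose n : nat := (N + `|j|).+1.
have := congr1 (fun g : laurent k => g@_(j + n)) (fC (laurent_X k n)).
rewrite mulrC mcoeff_mulX addrK /= laurent_invX -scalerAr mcoeffZ mcoeff_mulX => ->.
rewrite NP ?mulr0 // /n; lia.
Qed.

End Invariants.

Section Involution.
Variables (k : fieldType) (R : comAlgType k) (sigma : alg_aut R) (a : center R).
Hypothesis sigmaK : involutive sigma.
Local Notation A := (gwa sigma a).
Local Notation C := (@gwa_const k R sigma a).
Local Notation x := (gwa_x sigma a).
Local Notation y := (gwa_y sigma a).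
Local Notation w := (gwa_basis sigma a).

Lemma aut_inv_involutive r : aut_inv sigma r = sigma r.
Proof. by apply: (can_inj (aut_funK sigma)); rewrite aut_invK sigmaK. Qed.

Lemma gwa_central_gen z :
  (forall r, z * C r = C r * z) -> z * x = x * z -> z * y = y * z ->
  z \in @is_central k A.
Proof.
move=> zC zx zy; apply/is_centralP; elim/gwa_elim => // [u IH|u v IHu IHv|u v IHu IHv].
- by rewrite mulrN mulNr IH.
- by rewrite mulrDl mulrDr IHu IHv.
- by rewrite mulrA IHu -mulrA IHv mulrA.
Qed.

Lemma gwa_x2_central : x ^+ 2 \in @is_central k A.
Proof.
apply: gwa_central_gen => [r||].
- by rewrite -mulrA gwa_xrE mulrA gwa_xrE sigmaK mulrA.
- by rewrite -exprSr -exprS.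
- by rewrite mulrA gwa_yxE -mulrA gwa_xyE gwa_xrE sigmaK.
Qed.

Lemma gwa_y2_central : y ^+ 2 \in @is_central k A.
Proof.
apply: gwa_central_gen => [r||].
- by rewrite -mulrA gwa_yrE mulrA gwa_yrE !aut_inv_involutive sigmaK mulrA.
- by rewrite mulrA gwa_xyE -mulrA gwa_yxE gwa_yrE aut_inv_involutive.
- by rewrite -exprSr -exprS.
Qed.

Lemma gwa_const_central r : sigma r = r -> C r \in @is_central k A.
Proof.
move=> sr; apply: gwa_central_gen => [s||].
- by rewrite -!rmorphM mulrC.
- by rewrite gwa_xrE sr.
- by rewrite gwa_yrE aut_inv_involutive sr.
Qed.

Lemma gwa_coefMC u r j :
  gwa_coef (u * C r) j = gwa_coef u j * (if odd `|j| then sigma r else r).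
Proof.
have xC n : x ^+ n * C r = C (if odd n then sigma r else r) * x ^+ n.
  elim: n => [|n IH]; first by rewrite mulr1 mul1r.
  by rewrite exprS -mulrA IH mulrA gwa_xrE -mulrA /=; case: odd => //=; rewrite sigmaK.
have yC n : y ^+ n * C r = C (if odd n then sigma r else r) * y ^+ n.
  elim: n => [|n IH]; first by rewrite mulr1 mul1r.
  rewrite exprS -mulrA IH mulrA gwa_yrE -mulrA aut_inv_involutive /=.
  by case: odd => //=; rewrite sigmaK.
elim/gwa_span_ind: u => [|s i|u v IHu IHv].
- by rewrite mul0r !gwa_coef0 mul0r.
- have -> : C s * w i * C r = C (s * if odd `|i| then sigma r else r) * w i.
    by rewrite rmorphM -!mulrA; congr (_ * _); case: i => n; [apply: xC | apply: yC].
  by rewrite !gwa_coefU; case: eqP => [->|_]; rewrite ?mul0r.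
- by rewrite mulrDl !gwa_coefD IHu IHv mulrDl.
Qed.

Lemma gwa_coef_central_odd u j r :
  u \in @is_central k A -> odd `|j| -> r * gwa_coef u j = gwa_coef u j * sigma r.
Proof.
move=> /is_centralP uC jodd.
by rewrite -gwa_coefCM -uC gwa_coefMC jodd.
Qed.

End Involution.

Theorem lemma3p4 (k : fieldType) (q : k) (q0 : q != 0)
    (q_sqrt : exists s : k, s ^+ 2 = q)
    (a : laurent k) (a_nonmonomial : ~ laurent_monomial a) :
  alg_isomorphic
    (center (gwa (sigma_inv q0) (com_central a)))
    (gwa (id_aut (adjoin (laurent_trace q)))
         (com_central (@Adjoin k (laurent k) (laurent_trace q) (a * sigma_inv q0 a)
                               (laurent_norm_mem q0 a)))).
Proof.
pose A : algType k := gwa (sigma_inv q0) (com_central a); set b := com_central (Adjoin _).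
pose C : {lrmorphism laurent k -> A} :=
  @gwa_const k (laurent k) (sigma_inv q0) (com_central a).
pose x : A := gwa_x _ _; pose y : A := gwa_y _ _.
pose S := adjoin (laurent_trace q).
have sigmaK : involutive (sigma_inv q0) := laurent_invK q0.
have sigmaS (s : S) : sigma_inv q0 (val s) = val s by apply/adjoin_trace_fixed/(valP s).
pose f0 (s : S) : A := C (val s).
have fL : linear f0 by move=> c s t; rewrite -[RHS]linearP.
have fM : monoid_morphism f0 by split=> [|s t]; rewrite /f0 -?rmorphM -?[RHS](rmorph1 C).
pose f : {lrmorphism S -> A} := HB.pack f0
  (GRing.isLinear.Build k S A *:%R f0 fL) (GRing.isMonoidMorphism.Build S A f0 fM).
have fC (s : S) z : z * f s = f s * z.
  by have /is_centralP -> := gwa_const_central (com_central a) sigmaK (sigmaS s).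
have yx : y ^+ 2 * x ^+ 2 = f (val b).
  rewrite -mulrA [y * (x * x)]mulrA gwa_yxE mulrA gwa_yrE -mulrA gwa_yxE -rmorphM.
  by rewrite aut_inv_involutive // mulrC.
have xy : x ^+ 2 * y ^+ 2 = f (val b).
  by have /is_centralP -> := gwa_x2_central (com_central a) sigmaK.
have [G [[GL [G1 GM] GC Gx Gy] _]] :=
  gwa_universal (sigma := id_aut S) (a := b) (f := f) yx xy
    (fun s => fC s _) (fun s => fC s _).
have GD u v : G (u + v) = G u + G v by rewrite -[u]scale1r GL !scale1r.
have G0 : G 0 = 0 by apply: (addrI (G 0)); rewrite -GD !addr0.
have GX u n : G (u ^+ n) = G u ^+ n.
  by elim: n => [|n IH]; rewrite ?G1 // !exprS GM IH.
have Gw s i : G (gwa_const _ _ s * gwa_basis _ _ i) = f s * gwa_basis _ _ (i + i).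
  rewrite GM -[in LHS]/((G \o gwa_const _ _) s) GC; congr (_ * _).
  case: i => n; rewrite [LHS]GX ?Gx ?Gy -exprM.
    by rewrite mul2n -addnn.
  rewrite (_ : Negz n + Negz n = Negz (n + n.+1)) ?mul2n -?addnn //.
  by rewrite !NegzE -opprD.
apply: (alg_isomorphic_center GL (conj G1 GM)) => [u v uv|z].
  have coefG t i : gwa_coef (G t) (i + i) = val (gwa_coef t i).
    elim/gwa_span_ind: t => [|s j|t t' IH IH'].
    - by rewrite G0 !gwa_coef0.
    - rewrite Gw !gwa_coefU (_ : (i + i == j + j) = (i == j)); last lia.
      by case: eqP.
    - by rewrite GD !gwa_coefD IH IH'.
  by apply: gwa_coef_inj => i; apply: val_inj; rewrite -!coefG uv.
split=> [zC|[u <-]].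
  have [J ->] := gwa_coefE z.
  apply: (big_ind (fun v => exists t, G t = v)) => [|_ _ [t <-] [t' <-]|j _]; first by exists 0.
    by exists (t + t').
  have [jodd|jeven] := boolP (odd `|j|).
    exists 0; rewrite G0 (@laurent_twisted_eq0 _ _ q0 (gwa_coef z j)) ?rmorph0 ?mul0r //.
    by move=> r; apply: gwa_coef_central_odd.
  have cS := fixed_adjoin_trace (gwa_coef_central_fixed j zC).
  have [i ji] : exists i, j = i + i by exists (j %/ 2)%Z; lia.
  by exists (gwa_const _ _ (Adjoin cS) * gwa_basis _ _ i); rewrite Gw -ji.
elim/gwa_span_ind: u => [|s i|u v IHu IHv].
- by rewrite G0 rpred0.
- rewrite GM -[G (gwa_const _ _ s)]/((G \o gwa_const _ _) s) GC.
  apply: rpredM; first exact: gwa_const_central.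
  case: i => n; rewrite [G _]GX ?Gx ?Gy; apply: rpredX.
    exact: gwa_x2_central.
  exact: gwa_y2_central.
- by rewrite GD rpredD.
Qed.
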